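(* Fix $T$ with $1<T<\tfrac43$ and a constant $p\in(0,1)$. Consider the PD process on the $n$-vertex cycle where the initial configuration $C_0$ makes each vertex a cooperator independently with probability $p$, and let $r_f$ be the density of cooperators in the stable configuration reached. Then asymptotically almost surely (as $n\to\infty$) $3p^5(1-p)^2\le r_f\le p$.
   Context: A configuration on a graph $G=(V,E)$ is a map $C:V\to\{0,1\}$; $1$ means cooperator, $0$ means defector. The pay-off $f(a,b)$ to a player with strategy $a$ against strategy $b$ is $f(0,0)=0$, $f(0,1)=T$, $f(1,0)=0$, $f(1,1)=1$. The score of $v$ is $s(v)=\sum_{x\in N(v)} f(C(v),C(x))$. The most successful neighbours of $v$ are the vertices of $N[v]$ of maximum score (defectors taken as most successful in case of a tie between a cooperator and a defector). A vertex is weak if its strategy differs from that of its most successful neighbours; updating a vertex changes its strategy if it is currently weak and does nothing otherwise. PD process: given $C_t$, let $W_t$ be the set of weak vertices; if $W_t=\emptyset$ the process stops and $C_t$ is stable. Otherwise a uniformly random ordering of $W_t$ is chosen and the vertices are updated one at a time in that order, each with respect to the current configuration, producing $C_{t+1}$. On the $n$-vertex cycle ($n\ge3$) the process always reaches a stable configuration; $r_f$ is the fraction of cooperators in it. Asymptotically almost surely means with probability tending to $1$ as $n\to\infty$. *)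

(* Defs.v *)
From HB Require Import structures.
From mathcomp Require Import all_boot all_order all_algebra.
From mathcomp Require Import all_classical all_reals all_analysis.

Set Implicit Arguments.
Unset Strict Implicit.
Unset Printing Implicit Defensive.

Import Order.TTheory GRing.Theory Num.Theory.
Import numFieldNormedType.Exports.

Local Open Scope ring_scope.

(* A configuration on V is a {ffun V -> bool}; true is a cooperator (1) and
   false a defector (0). A graph is given by its adjacency relation e. *)

Definition payoff (R : realType) (T : R) (a b : bool) : R :=
  match a, b with
  | false, false => 0
  | false, true => T
  | true, false => 0
  | true, true => 1
  end.

Section PrisonersDilemma.
Variables (R : realType) (V : finType) (e : rel V) (T : R).
Implicit Types (C D : {ffun V -> bool}) (v : V) (p : R).

Definition closed_nbhd v : {set V} := [set x | (x == v) || e v x].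

Definition score C v : R := \sum_(x | e v x) payoff T (C v) (C x).

Definition top_scorers C v : {set V} :=
  [set u in closed_nbhd v | [forall x in closed_nbhd v, score C x <= score C u]].

(* Ties between cooperators and defectors are resolved for the defectors, so
   all the members of this (nonempty) set have the same strategy. *)
Definition most_successful C v : {set V} :=
  if [exists u in top_scorers C v, ~~ C u]
  then [set u in top_scorers C v | ~~ C u]
  else top_scorers C v.

Definition weak C v : bool := [exists u in most_successful C v, C u != C v].

Definition weak_set C : {set V} := [set v | weak C v].

Definition stable C : bool := weak_set C == finset.set0.

Definition update C v : {ffun V -> bool} :=
  if weak C v then [ffun x => if x == v then ~~ C v else C x] else C.

Definition orderings C : seq (seq V) := permutations (enum (weak_set C)).

(* Transition probability from C to D. A stable C has the empty sequence as
   its only ordering, so stable configurations are absorbing. *)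
Definition step_prob C D : R :=
  (\sum_(s <- orderings C) (foldl update C s == D)%:R)
    / (size (orderings C))%:R.

Definition init_prob p C : R := \prod_v (if C v then p else 1 - p).

Fixpoint law p (t : nat) C : R :=
  if t is t'.+1 then \sum_D law p t' D * step_prob D C else init_prob p C.

(* Probability that the process reaches a stable configuration and that this
   configuration is D: since stable configurations are absorbing, it is the
   limit of the (nondecreasing in t) probabilities that C_t = D. *)
Definition final_prob p D : R :=
  if stable D then lim (law p t D @[t --> \oo])%classic else 0.

Definition final_Pr p (A : pred {ffun V -> bool}) : R :=
  \sum_(D | A D) final_prob p D.

Definition coop_density C : R := #|[set v | C v]|%:R / #|V|%:R.

End PrisonersDilemma.

Section FinalLaw.
Variables (R : realType) (V : finType) (e : rel V) (T : R).
Implicit Types (C D : {ffun V -> bool}) (p : R).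

Lemma size_orderings_gt0 C : (0 < size (orderings e T C))%N.
Proof. by rewrite /orderings size_permutations ?enum_uniq // fact_gt0. Qed.

Lemma step_prob_ge0 C D : 0 <= step_prob e T C D.
Proof. by rewrite /step_prob divr_ge0 ?ler0n // sumr_ge0. Qed.

Lemma sum_step_prob C : \sum_D step_prob e T C D = 1.
Proof.
rewrite /step_prob -mulr_suml exchange_big /=.
under eq_bigr => s _.
  rewrite (bigD1 (foldl (update e T) C s)) //= eqxx big1 ?addr0; last first.
    by move=> D; rewrite eq_sym => /negPf ->.
  over.
rewrite big_const_seq count_predT iter_addr_0 divff // pnatr_eq0.
by rewrite -lt0n size_orderings_gt0.
Qed.

Lemma step_prob_stable C : stable e T C -> step_prob e T C C = 1.
Proof.
move=> /eqP sC; rewrite /step_prob /orderings sC enum_set0.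
have -> : permutations (Nil V) = [:: [::]] by [].
by rewrite big_seq1 eqxx divr1.
Qed.

Lemma sum_init_prob p : \sum_C @init_prob R V p C = 1.
Proof.
rewrite /init_prob.
rewrite -(bigA_distr_bigA (fun v (b : bool) => if b then p else 1 - p)) /=.
by rewrite big1 // => v _; rewrite big_bool /= addrC subrK.
Qed.

Lemma sum_law p t : \sum_C law e T p t C = 1.
Proof.
elim: t => [|t IH]; first exact: sum_init_prob.
rewrite /= exchange_big /= -[RHS]IH; apply: eq_bigr => D _.
by rewrite -mulr_sumr sum_step_prob mulr1.
Qed.

Lemma law_ge0 p t C : 0 <= p <= 1 -> 0 <= law e T p t C.
Proof.
move=> /andP[p0 p1]; elim: t C => [|t IH] C /=.
  by apply: prodr_ge0 => v _; case: ifP => _ //; rewrite subr_ge0.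
by apply: sumr_ge0 => D _; rewrite mulr_ge0 ?step_prob_ge0.
Qed.

(* The limit in final_prob exists. *)
Lemma is_cvg_law_stable p D : 0 <= p <= 1 -> stable e T D ->
  cvgn (fun t => law e T p t D).
Proof.
move=> hp sD; apply: nondecreasing_is_cvgn.
  apply/nondecreasing_seqP => t /=.
  rewrite (bigD1 D) //= step_prob_stable // mulr1 lerDl sumr_ge0 // => C _.
  by rewrite mulr_ge0 ?law_ge0 ?step_prob_ge0.
exists 1 => _ [t _ <-]; rewrite -(sum_law p t) (bigD1 D) //= lerDl.
by rewrite sumr_ge0 // => C _; rewrite law_ge0.
Qed.

End FinalLaw.

(* The n-vertex cycle, a simple graph when n >= 3 (ordS is i |-> i + 1 mod n). *)
Definition cycle_adj (n : nat) : rel 'I_n :=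
  fun i j => (j == ordS i) || (i == ordS j).

(* Main.v *)
(** On a cycle with 1 < T < 2 a defector next to a cooperator scores at least T,
    while that cooperator scores at most 1, so defectors are never weak and the
    set of cooperators only shrinks; in particular the process stops after at
    most n + 1 rounds. An isolated cooperator is always weak, so every final
    cooperator already had a cooperating neighbour at time 0. Conversely the
    local pattern "three consecutive cooperators such that, on either side, the
    vertex at distance 3 from the middle cooperates only if the one at distance
    2 does" is never destroyed. Hence the final number of cooperators lies
    between two sums of indicators of local patterns of C_0, of means
    n p^3 (1 - p(1-p))^2 > 3 n p^5 (1-p)^2 and n p (1 - (1-p)^2) < n p, and
    Chebyshev's inequality concludes. *)
Require Import Defs.
From mathcomp Require Import all_boot all_order all_algebra.
From mathcomp Require Import all_classical all_reals all_analysis.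
From mathcomp Require Import ring lra.

Set Implicit Arguments.
Unset Strict Implicit.
Unset Printing Implicit Defensive.

Import Order.TTheory GRing.Theory Num.Theory.
Import numFieldNormedType.Exports.
Local Open Scope ring_scope.

(** * Expectation under the random initial configuration, independence, Chebyshev's inequality *)

Section ProductMeasure.
Variables (R : realType) (V : finType) (p : R).
Hypothesis p01 : 0 <= p <= 1.
Implicit Types (C D : {ffun V -> bool}) (A B : {set V}).
Implicit Types f g : {ffun V -> bool} -> R.

Definition expect f : R := \sum_C init_prob p C * f C.

Definition depends_on (U : Type) A (f : {ffun V -> bool} -> U) :=
  forall C D, {in A, C =1 D} -> f C = f D.

Lemma init_prob_ge0 C : 0 <= init_prob p C.
Proof.
by apply: prodr_ge0 => v _; case: ifP => _; move: p01; lra.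
Qed.

Lemma expect_le f g : (forall C, f C <= g C) -> expect f <= expect g.
Proof.
by move=> fg; apply: ler_sum => C _; rewrite ler_wpM2l ?init_prob_ge0.
Qed.

Lemma eq_expect f g : f =1 g -> expect f = expect g.
Proof. by move=> fg; apply: eq_bigr => C _; rewrite fg. Qed.

Lemma expectD f g : expect (fun C => f C + g C) = expect f + expect g.
Proof. by rewrite -big_split; apply: eq_bigr => C _; rewrite mulrDr. Qed.

Lemma expectZ a f : expect (fun C => a * f C) = a * expect f.
Proof. by rewrite mulr_sumr; apply: eq_bigr => C _; rewrite mulrCA. Qed.

Lemma expect_sum (I : finType) (F : I -> {ffun V -> bool} -> R) :
  expect (fun C => \sum_i F i C) = \sum_i expect (F i).
Proof.
by rewrite exchange_big; apply: eq_bigr => C _; rewrite mulr_sumr.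
Qed.

Lemma expect_cst a : expect (fun=> a) = a.
Proof. by rewrite /expect -mulr_suml sum_init_prob mul1r. Qed.

(** Absorbing [h (C v)] into the factor at [v] leaves a product over vertices, so the sum over
    configurations factorizes; every other factor sums to 1. *)
Lemma expect_site (h : bool -> R) v :
  expect (fun C => h (C v)) = p * h true + (1 - p) * h false.
Proof.
pose w u (b : bool) :=
  (if b then p else 1 - p) * (if u == v then h b else 1).
rewrite /expect (eq_bigr (fun C : {ffun V -> bool} => \prod_u w u (C u))).
  rewrite -(bigA_distr_bigA w) (bigD1 v) //= big_bool /w /= eqxx big1 ?mulr1//.
  by move=> u /negPf uv; rewrite big_bool /= uv; ring.
move=> C _; rewrite /w big_split /=; congr (_ * _).
by rewrite -big_mkcond big_pred1_eq.
Qed.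

Definition splice A C D : {ffun V -> bool} :=
  [ffun x => if x \in A then C x else D x].

(* Two independent samples that exchange their values off A are again two
   independent samples: this turns E f * E g into E (f * g). *)
Lemma expectM A f g : depends_on A f -> depends_on (~: A) g ->
  expect (fun C => f C * g C) = expect f * expect g.
Proof.
move=> fA gA; pose W (x : {ffun V -> bool} * {ffun V -> bool}) :=
  init_prob p x.1 * init_prob p x.2.
pose sw (x : {ffun V -> bool} * {ffun V -> bool}) :=
  (splice A x.1 x.2, splice A x.2 x.1).
have swK : involutive sw.
  move=> [C D]; congr (_, _); apply/ffunP => x; rewrite ffunE /sw /= !ffunE;
  by case: (x \in A).
have Wsw x : W (sw x) = W x.
  rewrite /W /sw /init_prob -!big_split; apply: eq_bigr => v _ /=.
  by rewrite !ffunE; case: (v \in A) => //; rewrite mulrC.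
transitivity (\sum_x W x * (f x.1 * g x.2)); last first.
  rewrite /expect big_distrlr /= pair_bigA /=.
  by apply: eq_bigr => x _; rewrite /W mulrACA.
rewrite (reindex_inj (inv_inj swK)) /=.
transitivity (\sum_x W x * (f x.1 * g x.1)).
  rewrite -(pair_bigA _ (fun C D => W (C, D) * (f C * g C))) /W /=.
  by apply: eq_bigr => C _; rewrite -mulr_suml -mulr_sumr sum_init_prob mulr1.
apply: eq_bigr => -[C D] _; rewrite Wsw /=; congr (_ * (_ * _)).
  by apply: fA => x xA; rewrite ffunE xA.
by apply: gA => x; rewrite inE => /negPf xA; rewrite ffunE xA.
Qed.

Lemma expect_andb A (f g : pred {ffun V -> bool}) :
  depends_on A f -> depends_on (~: A) g ->
  expect (fun C => (f C && g C)%:R) =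
  expect (fun C => (f C)%:R) * expect (fun C => (g C)%:R).
Proof.
move=> fA gA; rewrite -(expectM (A := A)).
- by apply: eq_expect => C; rewrite -mulnb natrM.
- by move=> C D /fA ->.
- by move=> C D /gA ->.
Qed.

Lemma expect_negb (f : pred {ffun V -> bool}) :
  expect (fun C => (~~ f C)%:R) = 1 - expect (fun C => (f C)%:R).
Proof.
apply/eqP; rewrite eq_sym subr_eq -expectD -[X in X == _](expect_cst 1).
by apply/eqP/eq_expect => C; case: (f C); rewrite ?addr0 ?add0r.
Qed.

Lemma expect_coop v : expect (fun C => (C v)%:R) = p.
Proof. by rewrite (expect_site (fun b => b%:R)) mulr0 addr0 mulr1. Qed.

Lemma expect_defect v : expect (fun C => (~~ C v)%:R) = 1 - p.
Proof. by rewrite expect_negb expect_coop. Qed.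

(** The implication fails exactly when [u] cooperates and [v] defects, two independent events. *)
Lemma expect_implyb u v : u != v ->
  expect (fun C => (C u ==> C v)%:R) = 1 - p * (1 - p).
Proof.
move=> uv; under eq_expect do rewrite implybE -[_ || _]negbK negb_or negbK.
rewrite expect_negb (expect_andb (A := [set u])) ?expect_coop ?expect_defect //.
  by move=> C D h; rewrite h ?inE.
by move=> C D h; rewrite h // !inE eq_sym.
Qed.

Lemma depends_onS (U : Type) A B (f : {ffun V -> bool} -> U) :
  A \subset B -> depends_on A f -> depends_on B f.
Proof. by move=> /fintype.subsetP AB fA C D CD; apply: fA => x /AB /CD. Qed.

(* Chebyshev: only the pairs (v, w) with w \in nb v contribute to the variance. *)
Lemma expect_deviation (X : V -> {ffun V -> bool} -> bool) (mu eps : R)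
    (K : nat) (supp nb : V -> {set V}) :
  0 < eps -> (0 < #|V|)%N ->
  (forall v, expect (fun C => (X v C)%:R) = mu) ->
  (forall v, depends_on (supp v) (X v)) ->
  (forall v w, w \notin nb v -> [disjoint supp v & supp w]) ->
  (forall v, #|nb v| <= K)%N ->
  expect (fun C =>
    (eps * #|V|%:R < `|\sum_v (X v C)%:R - mu * #|V|%:R|)%R%:R)
    <= K%:R / (eps ^+ 2 * #|V|%:R).
Proof.
move=> eps0 V0 EX dX disj nbK; set n : R := #|V|%:R.
have n0 : 0 < n by rewrite ltr0n.
pose Y v C : R := (X v C)%:R - mu.
have dY v : depends_on (supp v) (Y v) by move=> C D /(@dX v) e; rewrite /Y e.
have mu01 : 0 <= mu <= 1.
  case/card_gt0P: V0 => v _; rewrite -(EX v); apply/andP; split.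
    by rewrite -(expect_cst 0) expect_le.
  by rewrite -[leRHS](expect_cst 1) expect_le // => C; rewrite lern1 leq_b1.
have EY v : expect (Y v) = 0.
  by rewrite /Y expectD EX (expect_cst (- mu)) subrr.
(* The centred indicators have absolute value at most 1, which bounds each covariance by 1; disjoint
   supports make it vanish. *)
have cov v w : expect (fun C => Y v C * Y w C) <= (w \in nb v)%:R.
  case: (boolP (w \in nb v)) => [_|/disj vw].
    rewrite -[leRHS](expect_cst 1); apply: expect_le => C; rewrite /Y.
    by case: (X v C); case: (X w C) => /=; nra.
  rewrite (expectM (dY v)) ?EY ?mul0r //; apply: depends_onS (dY w).
  by rewrite -finset.disjoints_subset disjoint_sym.
have varle : expect (fun C => (\sum_v Y v C) ^+ 2) <= n * K%:R.
  rewrite (@eq_expect _ (fun C => \sum_v \sum_w Y v C * Y w C)); last first.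
    by move=> C; rewrite expr2 big_distrlr.
  rewrite expect_sum /n -natrM -sum_nat_const natr_sum; apply: ler_sum => v _.
  rewrite expect_sum (le_trans (ler_sum _ (fun w _ => cov v w))) //.
  by rewrite -natr_sum ler_nat -big_mkcond sum1_card nbK.
have -> : K%:R / (eps ^+ 2 * n) = (eps * n) ^- 2 * (n * K%:R).
  by field; rewrite !gt_eqF.
apply: le_trans (ler_wpM2l _ varle); last by rewrite invr_ge0 sqr_ge0.
(* Markov's inequality for the square: where the deviation exceeds [eps * n], its square divided by
   that of [eps * n] is at least 1. *)
rewrite -expectZ; apply: expect_le => C.
have -> : \sum_v Y v C = \sum_v (X v C)%:R - mu * n.
  by rewrite sumrB sumr_const -mulr_natr.
set S := _ - _; case: ltP => [h|_] /=; last first.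
  by rewrite mulr_ge0 ?invr_ge0 ?sqr_ge0.
rewrite ler_pdivlMl ?exprn_gt0 ?mulr_gt0 // mulr1 -[leRHS]real_normK ?num_real //.
by rewrite lerXn2r ?nnegrE ?normr_ge0 ?ltW // mulr_gt0.
Qed.

End ProductMeasure.

(** * Weak vertices and single updates on an arbitrary graph *)

Section Weakness.
Variables (R : realType) (V : finType) (e : rel V) (T : R).
Implicit Types (C D : {ffun V -> bool}) (v u x : V).

Lemma weak_coopP C v : C v ->
  reflect (exists2 u, (u \in closed_nbhd e v) && ~~ C u &
             {in closed_nbhd e v, forall x, score e T C x <= score e T C u})
          (weak e T C v).
Proof.
move=> Cv; rewrite /weak /most_successful.
have topP u : (u \in top_scorers e T C v) = (u \in closed_nbhd e v) &&
    [forall x in closed_nbhd e v, score e T C x <= score e T C u].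
  by rewrite inE.
apply: (iffP idP); case: ifP => [_ | /negbT/existsPn no].
- case/existsP=> u /andP[]; rewrite inE topP.
  by move=> /andP[/andP[uv /forall_inP max] Cu] _; exists u => //; rewrite uv.
- case/existsP=> u /andP[ut]; rewrite Cv eqb_id => Cu.
  by have := no u; rewrite ut Cu.
- case=> u /andP[uv Cu] max; apply/existsP; exists u.
  by rewrite inE topP uv Cu Cv (negPf Cu) !andbT; apply/forall_inP.
- case=> u /andP[uv Cu] max; have := no u; rewrite topP uv Cu andbT.
  by move=> /negP[]; apply/forall_inP.
Qed.

(** The inequality is strict because [v] belongs to its own closed neighbourhood and, as a defector,
    would win a tie. *)
Lemma weak_defP C v : ~~ C v -> weak e T C v ->
  exists2 u, (u \in closed_nbhd e v) && C u & score e T C v < score e T C u.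
Proof.
move=> /negPf Cv; rewrite /weak /most_successful.
have vv : v \in closed_nbhd e v by rewrite inE eqxx.
case: ifP => [_ /existsP[u /andP[]] | /negbT/existsPn no /existsP[u /andP[]]].
  by rewrite inE => /andP[_ /negPf ->]; rewrite Cv.
rewrite inE Cv eqbF_neg negbK => /andP[uv /forall_inP max] Cu.
exists u; first by rewrite uv.
rewrite ltNge; apply/negP => le.
have := no v; rewrite inE vv Cv andbT => /negP[]; apply/forall_inP => x /max.
by move/le_trans; apply.
Qed.

Lemma update_le C x v : ~~ weak e T C x || C x -> update e T C x v -> C v.
Proof.
rewrite /update; case: ifP => //= wx Cx.
by rewrite ffunE; case: eqP => // -> ; rewrite Cx.
Qed.

Lemma update_notweak C x v : ~~ weak e T C v -> update e T C x v = C v.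
Proof.
rewrite /update; case: ifP => // wx; rewrite ffunE.
by case: eqP => // ->; rewrite wx.
Qed.

Lemma update_weak C x : weak e T C x -> C x -> update e T C x x = false.
Proof. by rewrite /update => -> Cx; rewrite ffunE eqxx Cx. Qed.

End Weakness.

(** * Dynamics on the cycle: shrinking cooperation and preserved patterns *)

Section Cycle.
Variables (R : realType) (n : nat) (T : R).
Hypotheses (T_gt1 : 1 < T) (T_lt2 : T < 2) (n_gt2 : (2 < n)%N).
Implicit Types (C D : {ffun 'I_n -> bool}) (v : 'I_n).
Local Notation e := (@cycle_adj n).
Local Notation s := (@ordS n).

Lemma iter_ordSE i v : iter i s v = ((v + i) %% n)%N :> nat.
Proof.
elim: i => [|i IH] /=; first by rewrite addn0 modn_small.
by rewrite IH -addn1 modnDml addn1 addnS.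
Qed.

Lemma iter_ordS_eq i j v : (i < n)%N -> (j < n)%N ->
  (iter i s v == iter j s v) = (i == j).
Proof.
move=> hi hj; rewrite -val_eqE /= !iter_ordSE eqn_modDl.
by rewrite !modn_small.
Qed.

(** Centring at [s v] names all three vertices by successors alone. *)
Lemma closed_nbhd_cycle v x :
  (x \in closed_nbhd e (s v)) = [|| x == v, x == s v | x == s (s v)].
Proof.
rewrite inE /cycle_adj (inj_eq (@ordS_inj n)) (eq_sym v).
by case: (x == v); case: (x == s v); case: (x == s (s v)).
Qed.

Lemma score_cycle C v : score e T C (s v) =
  payoff T (C (s v)) (C v) + payoff T (C (s v)) (C (s (s v))).
Proof.
(* With at least three vertices the two neighbours of [s v] are distinct, so the score has exactly
   two terms. *)
have ne : s (s v) != v by rewrite (@iter_ordS_eq 2 0) // (ltn_trans _ n_gt2).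
rewrite /score (bigD1 v) /=; last by rewrite /cycle_adj eqxx orbT.
rewrite (bigD1 (s (s v))) /=; last by rewrite /cycle_adj eqxx ne.
rewrite big1 ?addr0 // => x /andP[/andP[]].
rewrite /cycle_adj (inj_eq (@ordS_inj n)) (eq_sym v).
by case: (x == v); case: (x == s (s v)).
Qed.

(** A defector could only imitate a cooperating neighbour; that neighbour scores at most 1, while
    the defector scores at least [T]. *)
Lemma weak_coop C v : weak e T C v -> C v.
Proof.
apply: contraTT => Cv; apply/negP => /(weak_defP Cv)[u /andP[]].
case: (ordS_bij n) => g _ gK; move: Cv; rewrite -[v]gK; move: (g v) => {}v.
move=> /negPf Cv; rewrite closed_nbhd_cycle => /or3P[] /eqP -> Cu; last first.
- rewrite !score_cycle Cu Cv /=; case: (C v); case: (C (s (s (s v)))) => /=;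
  move: T_gt1; lra.
- by rewrite Cv in Cu.
move: Cu Cv; rewrite -[v]gK; move: (g v) => w Cu Cv; rewrite !score_cycle Cv Cu.
by case: (C w); case: (C (s (s (s w)))) => /=; move: T_gt1; lra.
Qed.

Lemma not_weak_inner C v : C v -> C (s (s v)) -> ~~ weak e T C (s v).
Proof.
move=> C0 C2; apply/negP => w; have C1 := weak_coop w.
case/(weak_coopP _ _ C1): w => u; rewrite closed_nbhd_cycle => /andP[uv Cu] _.
by case/or3P: uv Cu => /eqP->; rewrite ?C0 ?C1 ?C2.
Qed.

(** The only defector that [s (s v)] could imitate is [s v], which scores just [T] since [v]
    defects; the cooperator on the other side scores 2. *)
Lemma not_weak_left_end C v :
  ~~ C v -> C (s (s (s v))) -> C (s (s (s (s v)))) -> ~~ weak e T C (s (s v)).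
Proof.
move=> /negPf C0 C3 C4; apply/negP => w; have C2 := weak_coop w.
case/(weak_coopP _ _ C2): w => u; rewrite closed_nbhd_cycle => /andP[uv Cu].
move=> /(_ (s (s (s v)))); rewrite closed_nbhd_cycle eqxx !orbT => /(_ isT).
case/or3P: uv Cu => /eqP->; rewrite ?C2 ?C3 // !score_cycle C0 C2 C3 C4.
by move=> /negPf -> /=; move: T_lt2; lra.
Qed.

Lemma not_weak_right_end C v :
  C v -> C (s v) -> ~~ C (s (s (s (s v)))) -> ~~ weak e T C (s (s v)).
Proof.
move=> C0 C1 /negPf C4; apply/negP => w; have C2 := weak_coop w.
case/(weak_coopP _ _ C2): w => u; rewrite closed_nbhd_cycle => /andP[uv Cu].
move=> /(_ (s v)); rewrite closed_nbhd_cycle eqxx => /(_ isT).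
case/or3P: uv Cu => /eqP->; rewrite ?C2 ?C1 // !score_cycle C0 C1 C2 C4.
by move=> /negPf -> /=; move: T_lt2; lra.
Qed.

(** An isolated cooperator scores 0, so the better of its two defecting neighbours attains the
    maximum. *)
Lemma weak_isolated C v :
  C (s v) -> ~~ C v -> ~~ C (s (s v)) -> weak e T C (s v).
Proof.
case: (ordS_bij n) => g _ gK.
move=> C1 C0 C2; apply/weak_coopP => //.
have s1 : score e T C (s v) = 0.
  by rewrite score_cycle C1 (negPf C0) (negPf C2) addr0.
have pos x : ~~ C x -> 0 <= score e T C x.
  move=> /negPf Cx; rewrite -[x]gK score_cycle gK Cx.
  by case: (C _); case: (C _) => /=; move: T_gt1; lra.
have [le|/ltW le] := leP (score e T C v) (score e T C (s (s v))).
- exists (s (s v)); first by rewrite closed_nbhd_cycle eqxx !orbT.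
  by move=> x; rewrite closed_nbhd_cycle => /or3P[] /eqP -> //; rewrite s1 pos.
- exists v; first by rewrite closed_nbhd_cycle eqxx.
  by move=> x; rewrite closed_nbhd_cycle => /or3P[] /eqP -> //; rewrite s1 pos.
Qed.

(* Once the vertex outside one end of a cooperating triple has defected, its own
   outer neighbour is a defector too, so it scores only T < 2 and the triple
   resists. *)
Definition resistant v C : bool :=
  let c i := C (iter i s v) in
  [&& c 2, c 3, c 4, c 0 ==> c 1 & c 6 ==> c 5]%N.

Definition nonisolated v C : bool :=
  let c i := C (iter i s v) in (c 1 && (c 0 || c 2))%N.

Lemma update_coop C x v : update e T C x v -> C v.
Proof. by apply: update_le; rewrite -implybE; apply/implyP/weak_coop. Qed.

(** An end of the triple either has two cooperating neighbours or falls under one of the end lemmas.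
    The implications survive because a cooperator at position 0 forces one at 1, which then lies
    between cooperators; likewise for 6 and 5. *)
Lemma update_resistant C x v : resistant v C -> resistant v (update e T C x).
Proof.
move=> /and5P[/= c2 c3 c4 /implyP c01 /implyP c65].
have k2 : ~~ weak e T C (s (s v)).
  case: (boolP (C (s v))) => [c1|c1]; first exact: not_weak_inner.
  by apply: not_weak_left_end => //; apply: contra c1.
have k3 : ~~ weak e T C (s (s (s v))) by exact: not_weak_inner.
have k4 : ~~ weak e T C (s (s (s (s v)))).
  case: (boolP (C (s (s (s (s (s v))))))) => [c5|c5].
    exact: not_weak_inner.
  by apply: not_weak_right_end => //; apply: contra c5.
rewrite /resistant /= (update_notweak x k2) (update_notweak x k3).
rewrite (update_notweak x k4) c2 c3 c4 /=; apply/andP; split.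
  apply/implyP => /update_coop c0.
  by rewrite update_notweak ?c01 // not_weak_inner.
apply/implyP => /update_coop c6.
by rewrite update_notweak ?c65 // not_weak_inner.
Qed.

(** Relates a configuration to any later one; transitivity carries it from single updates to whole
    rounds. *)
Definition preserved C D :=
  (forall v, D v -> C v) /\ (forall v, resistant v C -> resistant v D).

Lemma preserved_trans C D E : preserved C D -> preserved D E -> preserved C E.
Proof.
by move=> [CD CD'] [DE DE']; split=> v h; [apply/CD/DE | apply/DE'/CD'].
Qed.

Lemma preserved_foldl C r : preserved C (foldl (update e T) C r).
Proof.
elim: r C => [|x r IH] C //=; apply: preserved_trans (IH _).
by split=> v; [apply: update_coop | apply: update_resistant].
Qed.

Definition coops C := #|[set v | C v]|.

(** The first vertex of the ordering is still weak when its turn comes, so it defects, and later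
    updates create no cooperator. *)
Lemma foldl_update_coops C r : r \in orderings e T C -> ~~ stable e T C ->
  (coops (foldl (update e T) C r) < coops C)%N.
Proof.
rewrite mem_permutations => perm_r /set0Pn[x0].
rewrite -mem_enum -(perm_mem perm_r); case: r perm_r => // x r perm_r _ /=.
have wx : weak e T C x.
  by have := mem_head x r; rewrite (perm_mem perm_r) mem_enum inE.
apply/proper_card/properP; split.
  apply/fintype.subsetP => v; rewrite !inE.
  by move/(proj1 (preserved_foldl _ r) v)/update_coop.
exists x; rewrite !inE ?(weak_coop wx) //.
by apply/negP => /(proj1 (preserved_foldl _ r)); rewrite update_weak ?(weak_coop wx).
Qed.

(** Sending [v] to the middle of its triple, at position 3, is injective. *)
Lemma resistant_coops C D : preserved C D ->
  (\sum_v resistant v C <= coops D)%N.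
Proof.
move=> [_ h]; rewrite -big_mkcond sum1_card /=.
rewrite -(@fintype.card_image _ _ (iter 3 s)); last first.
  by move=> x y /= /ordS_inj/ordS_inj/ordS_inj.
apply/subset_leq_card/fintype.subsetP => _ /fintype.imageP[v hv ->].
by rewrite inE; case/and5P: (h v hv).
Qed.

(** A cooperator of [D] that was isolated in [C] would still be isolated, hence weak, in [D]. *)
Lemma coops_nonisolated C D : preserved C D -> stable e T D ->
  (coops D <= \sum_v nonisolated v C)%N.
Proof.
move=> [h _] /eqP stD; rewrite /coops -sum1dep_card big_mkcond /=.
rewrite (reindex_inj (@ordS_inj n)) /=; apply: leq_sum => v _.
case: ifP => // D1; rewrite /nonisolated h //=.
case: (boolP (C v || _)) => //; rewrite negb_or => /andP[C0 C2].
have : weak e T D (s v).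
  by apply: weak_isolated => //; [apply: contra C0 | apply: contra C2]; apply: h.
by have := finset.in_set0 (s v); rewrite -stD inE => ->.
Qed.

Lemma card_coops_le C : (coops C <= n)%N.
Proof. by rewrite -[leqRHS]card_ord max_card. Qed.

End Cycle.

(** * Transition probabilities over several rounds *)

Section Kernel.
Variables (R : realType) (V : finType) (e : rel V) (T : R).
Implicit Types (C D E : {ffun V -> bool}).

(** Fixing the starting configuration allows it to be compared with the final one, which [law]
    averages away. *)
Fixpoint iter_step (t : nat) C D : R :=
  if t is t'.+1 then \sum_E iter_step t' C E * step_prob e T E D
  else (C == D)%:R.

Lemma law_iter_step (p : R) t D :
  law e T p t D = \sum_C init_prob p C * iter_step t C D.
Proof.
elim: t D => [|t IH] D /=.
  rewrite (bigD1 D) //= eqxx mulr1 big1 ?addr0 // => C /negPf ->.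
  by rewrite mulr0.
under eq_bigr do rewrite IH mulr_suml.
rewrite exchange_big; apply: eq_bigr => C _ /=.
by rewrite mulr_sumr; apply: eq_bigr => E _; rewrite mulrA.
Qed.

Lemma sum_iter_step t C : \sum_D iter_step t C D = 1.
Proof.
elim: t => [|t IH] /=.
  by rewrite (bigD1 C) //= eqxx big1 ?addr0 // => D; rewrite eq_sym => /negPf ->.
rewrite exchange_big -[RHS]IH; apply: eq_bigr => E _ /=.
by rewrite -mulr_sumr sum_step_prob mulr1.
Qed.

Lemma iter_step_ge0 t C D : 0 <= iter_step t C D.
Proof.
elim: t D => [|t IH] D /=; first by rewrite ler0n.
by apply: sumr_ge0 => E _; rewrite mulr_ge0 ?step_prob_ge0.
Qed.

Lemma orderings_stable C : stable e T C -> orderings e T C = [:: [::]].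
Proof. by move=> /eqP sC; rewrite /orderings sC enum_set0. Qed.

Lemma step_prob_stableE C D : stable e T C -> step_prob e T C D = (C == D)%:R.
Proof.
by move=> /orderings_stable sC; rewrite /step_prob sC big_seq1 divr1.
Qed.

Lemma step_prob_neq0 C D : step_prob e T C D != 0 ->
  exists2 r, r \in orderings e T C & foldl (update e T) C r = D.
Proof.
move=> h; case: (boolP (has (fun r => foldl (update e T) C r == D)
                            (orderings e T C))).
  by case/hasP => r rC /eqP rD; exists r.
move=> /hasPn no; case/eqP: h; rewrite /step_prob big_seq big1 ?mul0r //.
by move=> r /no /negPf ->.
Qed.

(** Induction along trajectories of positive probability. *)
Lemma iter_step_ind (P : nat -> {ffun V -> bool} -> {ffun V -> bool} -> Prop) :
  (forall C, P 0%N C C) ->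
  (forall t C D r, P t C D -> r \in orderings e T D ->
     P t.+1 C (foldl (update e T) D r)) ->
  forall t C D, iter_step t C D != 0 -> P t C D.
Proof.
move=> P0 PS; elim=> [|t IH] C D /=.
  by case: (eqVneq C D) => [->//|_]; rewrite eqxx.
move=> h; case: (boolP [exists E, iter_step t C E * step_prob e T E D != 0]).
  case/existsP => E; rewrite mulf_eq0 negb_or => /andP[/IH PE].
  by case/step_prob_neq0 => r rE <-; apply: PS.
move/existsPn => no; case/eqP: h; rewrite big1 // => E _.
by have /negPn/eqP := no E.
Qed.

End Kernel.

(** * Termination, and the law of the stable configuration *)

Section FinalCycle.
Variables (R : realType) (n : nat) (T p : R).
Hypotheses (T_gt1 : 1 < T) (T_lt2 : T < 2) (n_gt2 : (2 < n)%N).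
Hypothesis p01 : 0 <= p <= 1.
Implicit Types (C D E : {ffun 'I_n -> bool}).
Local Notation e := (@cycle_adj n).

Lemma iter_step_support t C D : (n < t)%N -> iter_step e T t C D != 0 ->
  preserved C D /\ stable e T D.
Proof.
(* Each round from an unstable configuration costs a cooperator, so the second alternative is
   impossible once [t] exceeds [n]. *)
move=> nt; pose P (t : nat) C D :=
  preserved C D /\ (stable e T D \/ (coops D + t <= n)%N).
move=> h; suff [CD [sD|le]] : P t C D.
- by [].
- by move: nt; rewrite ltnNge (leq_trans _ le) ?leq_addl.
move: h {nt}; apply: iter_step_ind => {t C D} [C|].
  by split => //; right; rewrite addn0 card_coops_le.
move=> t C D r [CD hD] rD; split.
  by apply: preserved_trans CD _; apply: preserved_foldl.
case: (boolP (stable e T D)) => sD.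
  by left; move: rD; rewrite orderings_stable // inE => /eqP ->.
case: hD => [|hD]; first by rewrite (negPf sD).
right; rewrite addnS -addSn (leq_trans _ hD) // leq_add2r.
exact: foldl_update_coops.
Qed.

Lemma law_unstable t D : (n < t)%N -> ~~ stable e T D -> law e T p t D = 0.
Proof.
move=> nt sD; rewrite law_iter_step big1 // => C _.
apply/eqP; rewrite mulf_eq0; apply/orP; right; apply: contraR sD.
by case/(iter_step_support nt).
Qed.

(** After more than [n] rounds all the mass sits on stable configurations, which are absorbing. *)
Lemma law_stationary t D : (n < t)%N -> law e T p t D = law e T p n.+1 D.
Proof.
elim: t => // t IH; rewrite ltnS leq_eqVlt => /orP[/eqP<- //|nt].
rewrite -IH //= (bigD1 D) //= [X in _ + X]big1 => [|E /negPf ED].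
  rewrite addr0; case: (boolP (stable e T D)) => sD.
    by rewrite step_prob_stable // mulr1.
  by rewrite law_unstable // mul0r.
case: (boolP (stable e T E)) => sE.
  by rewrite step_prob_stableE // ED mulr0.
by rewrite law_unstable // mul0r.
Qed.

Lemma final_prob_law D : final_prob e T p D = law e T p n.+1 D.
Proof.
rewrite /final_prob; case: ifP => [_|/negbT sD]; last by rewrite law_unstable.
apply/cvg_lim => //; apply: cvg_near_cst.
by exists n.+1 => // t /= nt; rewrite law_stationary.
Qed.

Lemma final_Pr_le1 (A : pred {ffun 'I_n -> bool}) : final_Pr e T p A <= 1.
Proof.
rewrite -(sum_law e T p n.+1) /final_Pr [leLHS]big_mkcond.
apply: ler_sum => D _; case: ifP => _; first by rewrite final_prob_law.
exact: law_ge0.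
Qed.

(** From a start satisfying [G], the whole mass of the kernel after [n.+1] rounds lies in [A]; this
    moves the estimate to the initial product measure. *)
Lemma final_Pr_ge (G A : pred {ffun 'I_n -> bool}) :
  (forall C D, G C -> preserved C D -> stable e T D -> A D) ->
  expect p (fun C => (G C)%:R) <= final_Pr e T p A.
Proof.
move=> GA; rewrite /final_Pr.
under eq_bigr do rewrite final_prob_law law_iter_step.
rewrite exchange_big; apply: ler_sum => C _; rewrite -mulr_sumr.
apply: ler_wpM2l; first exact: init_prob_ge0.
case: (boolP (G C)) => GC; last by apply: sumr_ge0 => D _; rewrite iter_step_ge0.
rewrite -(sum_iter_step e T n.+1 C) [leRHS]big_mkcond.
apply: ler_sum => D _; case: ifP => // AD.
suff /eqP -> : iter_step e T n.+1 C D == 0 by [].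
apply: contraFT AD => /(iter_step_support (ltnSn n))[CD sD].
exact: GA GC CD sD.
Qed.

End FinalCycle.

(** * Local windows and the probabilities of the two patterns *)

Section Windows.
Variables (R : realType) (n : nat) (p : R).
Hypothesis n_gt6 : (6 < n)%N.
Implicit Types (C D : {ffun 'I_n -> bool}) (v : 'I_n).
Local Notation s := (@ordS n).

Definition window v : {set 'I_n} := [set iter i s v | i : 'I_7].

(** The starting points of windows meeting [window v]: some steps forward to a common vertex, then
    some back. *)
Definition overlapping v : {set 'I_n} :=
  [set iter ij.2 (@ord_pred n) (iter ij.1 s v) | ij : 'I_7 * 'I_7].

Lemma card_overlapping v : (#|overlapping v| <= 49)%N.
Proof.
by apply: leq_trans (leq_imset_card _ _) _; rewrite card_prod !card_ord.
Qed.

Lemma window_disjoint v w :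
  w \notin overlapping v -> [disjoint window v & window w].
Proof.
apply: contraNT => /pred0Pn[x /andP[/imsetP[i _ ->] /imsetP[j _ vw]]].
apply/imsetP; exists (i, j) => //=; rewrite vw.
by elim: (j : nat) {vw} => //= k IH; rewrite -iterS iterSr ordSK.
Qed.

Lemma window_eq C D v i :
  {in window v, C =1 D} -> (i < 7)%N -> C (iter i s v) = D (iter i s v).
Proof. by move=> h hi; apply: h; apply/imsetP; exists (Ordinal hi). Qed.

Lemma resistant_window v : depends_on (window v) (resistant v).
Proof. by move=> C D h; rewrite /resistant !(window_eq h). Qed.

Lemma nonisolated_window v : depends_on (window v) (nonisolated v).
Proof. by move=> C D h; rewrite /nonisolated !(window_eq h). Qed.

(** As [n > 6], the seven positions are distinct, so the five conditions read disjoint sets of sites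
    and are independent. *)
Lemma expect_resistant v :
  expect p (fun C => (resistant v C)%:R) = p ^+ 3 * (1 - p * (1 - p)) ^+ 2.
Proof.
have ne i j : (i < 7)%N -> (j < 7)%N ->
    (iter i s v == iter j s v) = (i == j).
  by move=> hi hj; apply: iter_ordS_eq; apply: leq_trans n_gt6.
rewrite /resistant (expect_andb _ (A := [set iter 2 s v])); first last.
- by move=> C D h; rewrite !h // !inE ?ne.
- by move=> C D h; rewrite h ?inE.
rewrite (expect_andb _ (A := [set iter 3 s v])); first last.
- by move=> C D h; rewrite !h // !inE ?ne.
- by move=> C D h; rewrite h ?inE.
rewrite (expect_andb _ (A := [set iter 4 s v])); first last.
- by move=> C D h; rewrite !h // !inE ?ne.
- by move=> C D h; rewrite h ?inE.
rewrite (expect_andb _ (A := [set iter 0 s v; iter 1 s v])); first last.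
- by move=> C D h; rewrite !h // !inE ?ne.
- by move=> C D h; rewrite !h // !inE ?eqxx ?orbT.
by rewrite !expect_coop !expect_implyb ?ne //; ring.
Qed.

Lemma expect_nonisolated v :
  expect p (fun C => (nonisolated v C)%:R) = p * (1 - (1 - p) ^+ 2).
Proof.
have ne i j : (i < 7)%N -> (j < 7)%N ->
    (iter i s v == iter j s v) = (i == j).
  by move=> hi hj; apply: iter_ordS_eq; apply: leq_trans n_gt6.
rewrite /nonisolated (expect_andb _ (A := [set iter 1 s v])); first last.
- by move=> C D h; rewrite !h // !inE ?ne.
- by move=> C D h; rewrite h ?inE.
rewrite expect_coop; congr (_ * _).
under eq_expect do rewrite -[_ || _]negbK negb_or.
rewrite expect_negb (expect_andb _ (A := [set iter 0 s v])); first last.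
- by move=> C D h; rewrite !h // !inE ?ne.
- by move=> C D h; rewrite h ?inE.
by rewrite !expect_defect expr2.
Qed.

End Windows.

(** * Concentration of the pattern counts, and the limit *)

Lemma final_Pr_lower (R : realType) (T p : R) :
  1 < T -> T < 2 -> 0 < p < 1 ->
  exists c : R, forall n, (6 < n)%N -> 1 - c / n%:R <=
    final_Pr (@cycle_adj n) T p
      (fun C => 3 * p ^+ 5 * (1 - p) ^+ 2 <= coop_density R C <= p).
Proof.
move=> T1 T2 /andP[p0 p1].
pose mu1 := p ^+ 3 * (1 - p * (1 - p)) ^+ 2.
pose mu2 := p * (1 - (1 - p) ^+ 2).
(* [eps1] and [eps2] are the gaps between the means and the two claimed bounds. *)
pose eps1 := mu1 - 3 * p ^+ 5 * (1 - p) ^+ 2.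
pose eps2 := p * (1 - p) ^+ 2.
have p01 : 0 <= p <= 1 by rewrite !ltW.
have q0 : 0 < 1 - p by rewrite subr_gt0.
have eps2_gt0 : 0 < eps2 by rewrite mulr_gt0 ?exprn_gt0.
have eps1_gt0 : 0 < eps1.
  have -> : eps1 = p ^+ 3 * ((1 - p * (1 - p)) ^+ 2 - 3 * (p * (1 - p)) ^+ 2).
    by rewrite /eps1 /mu1; ring.
  (* With z = p(1-p) at most 1/4, (1-z)^2 is at least 9/16, while 3z^2 is at most 3/16. *)
  rewrite mulr_gt0 ?exprn_gt0 // subr_gt0.
  have : 0 < p * (1 - p) by rewrite mulr_gt0.
  have : p * (1 - p) <= 1 / 4 by have := sqr_ge0 (p - 1 / 2); nra.
  by move: (p * (1 - p)) => z; nra.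
exists (49 / eps1 ^+ 2 + 49 / eps2 ^+ 2) => n n6.
have n_gt0 : 0 < n%:R :> R by rewrite ltr0n (leq_trans _ n6).
have n2 : (2 < n)%N by rewrite (leq_trans _ n6).
pose S1 C : R := \sum_v (@resistant n v C)%:R.
pose S2 C : R := \sum_v (@nonisolated n v C)%:R.
pose bad1 C := eps1 * n%:R < `|S1 C - mu1 * n%:R|.
pose bad2 C := eps2 * n%:R < `|S2 C - mu2 * n%:R|.
have cardn : #|'I_n| = n by rewrite card_ord.
have b1 : expect p (fun C => (bad1 C)%:R) <= 49 / (eps1 ^+ 2 * n%:R).
  have := @expect_deviation R 'I_n p p01 (@resistant n) mu1 eps1 49
    (@window n) (@overlapping n); rewrite !cardn; apply => //.
  - exact: leq_trans n6.
  - by move=> v; apply: expect_resistant.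
  - exact: resistant_window.
  - exact: window_disjoint.
  - exact: card_overlapping.
have b2 : expect p (fun C => (bad2 C)%:R) <= 49 / (eps2 ^+ 2 * n%:R).
  have := @expect_deviation R 'I_n p p01 (@nonisolated n) mu2 eps2 49
    (@window n) (@overlapping n); rewrite !cardn; apply => //.
  - exact: leq_trans n6.
  - by move=> v; apply: expect_nonisolated.
  - exact: nonisolated_window.
  - exact: window_disjoint.
  - exact: card_overlapping.
pose G C := ~~ (bad1 C || bad2 C).
apply: le_trans (@final_Pr_ge _ _ _ _ T1 T2 n2 p01 G _ _).
  rewrite expect_negb lerD2l lerN2.
  (* Union bound over the two bad events. *)
  apply: (@le_trans _ _ (expect p (fun C => (bad1 C)%:R + (bad2 C)%:R))).
    apply: expect_le => // C.
    by case: (bad1 C); case: (bad2 C); rewrite /= ?addr0 ?add0r ?lerDl ?ler01.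
  rewrite expectD mulrDl -!mulrA -!invfM; exact: lerD.
move=> C D; rewrite /G negb_or /bad1 /bad2 -!leNgt !ler_distl.
move=> /andP[/andP[l1 _] /andP[_ l2]] CD sD.
have := resistant_coops CD; rewrite -(ler_nat R) natr_sum => d1.
have := coops_nonisolated T1 n2 CD sD; rewrite -(ler_nat R) natr_sum => d2.
rewrite /coop_density cardn ler_pdivlMr // ler_pdivrMr //.
have <- : mu1 * n%:R - eps1 * n%:R = 3 * p ^+ 5 * (1 - p) ^+ 2 * n%:R.
  by rewrite /eps1; ring.
have <- : mu2 * n%:R + eps2 * n%:R = p * n%:R by rewrite /mu2 /eps2; ring.
by rewrite (le_trans l1 d1) (le_trans d2 l2).
Qed.

Local Open Scope classical_set_scope.

Theorem theorem4p6 (R : realType) (T p : R)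
    (hT : 1 < T < 4 / 3) (hp : 0 < p < 1) :
  final_Pr (@cycle_adj n) T p
    (fun C => 3 * p ^+ 5 * (1 - p) ^+ 2 <= coop_density R C <= p)
    @[n --> \oo] --> (1 : R).
Proof.
have T1 : 1 < T by lra.
have T2 : T < 2 by lra.
have p01 : 0 <= p <= 1 by lra.
have [c lower] := final_Pr_lower T1 T2 hp.
apply/cvgrPdist_le => eps eps0; near=> n.
have n6 : (6 < n)%N by near: n; exists 7%N.
have n2 : (2 < n)%N by exact: leq_trans n6.
have n0 : 0 < n%:R :> R by rewrite ltr0n (leq_trans _ n6).
(* A probability is at most 1, so only the lower bound matters; it is within [eps] of 1 as soon as
   [n] is at least [c / eps]. *)
rewrite ger0_norm ?subr_ge0 ?final_Pr_le1 // lerBlDl -lerBlDr.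
apply: le_trans (lower n n6); rewrite lerD2l lerN2.
rewrite ler_pdivrMr // mulrC -ler_pdivrMr //.
by near: n; apply: nbhs_infty_ger.
Unshelve. all: by end_near.
Qed.
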